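(* Let $\Delta=(z_0^{(0)},z_1^{(0)},z_2^{(0)})$ with $z_i^{(0)}\in\mathbb{C}$ be an arbitrary triangle with $z_i^{(0)}\neq z_j^{(0)}$ for $i\neq j$, whose centroid is the origin, i.e. $z_0^{(0)}+z_1^{(0)}+z_2^{(0)}=0$. Define recursively, for $n\ge 1$ and $i\in\mathbb{Z}_3$, $$z_i^{(n)}=\tfrac{2}{3}\,r_i^{(n-1)}z_i^{(n-1)}-\tfrac13\, r_{i+1}^{(n-1)}z_{i+1}^{(n-1)}-\tfrac13\, r_{i+2}^{(n-1)}z_{i+2}^{(n-1)},\qquad r_i^{(n)}=\frac{|z_{i-1}^{(n)}|}{|z_i^{(n)}|}\quad(n\ge 0),$$ and put $\Delta^n=(z_0^{(n)},z_1^{(n)},z_2^{(n)})$. Assume that $\Delta^n$ is non-degenerate, that is, its vertices are pairwise distinct. Then the triangle $\Delta^n$ converges, for $n\to\infty$, to an equilateral triangle.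
   Context: Indices $i$ are taken modulo $3$. The centroid of a triangle $(z_0,z_1,z_2)$ is $\frac13(z_0+z_1+z_2)$; it is assumed without loss of generality to be the origin, and the recursion keeps it there. ''Non-degenerate'' here means only that the vertices are pairwise distinct.
   Formalization: If the initial vertices are collinear (allowed, e.g. 1, 2, −3), the triangles shrink to the point (0,0,0), so ''equilateral'' here means three equal side lengths, a single point included; for non-collinear initial triangles the limit is shown to have distinct vertices. *)

(* Defs.v *)
From mathcomp Require Import all_boot all_order all_algebra.
From mathcomp Require Import complex.
From mathcomp Require Import all_classical all_reals all_analysis.

Set Implicit Arguments.
Unset Strict Implicit.
Unset Printing Implicit Defensive.

Import Order.TTheory GRing.Theory Num.Theory numFieldNormedType.Exports.

Local Open Scope classical_set_scope.
Local Open Scope ring_scope.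

(* R[i] under a name whose declared type lets the modulus `|x| (a nonnegative
   real element of the same field) provide the topology of C. *)
Definition Cplx (R : realType) : numClosedFieldType := R[i]%C.

(* Vertices are indexed by 'Z_3, so that i + 1, i + 2 and i - 1 are taken
   modulo 3. *)
Definition triangle (R : realType) : Type := 'Z_3 -> Cplx R.

Definition nondegenerate_triangle (R : realType) (z : triangle R) : Prop :=
  forall i j, i != j -> z i != z j.

(* The point triangle (0,0,0) satisfies this; nondegeneracy is a separate
   condition. *)
Definition equilateral_triangle (R : realType) (z : triangle R) : Prop :=
  `|z 0 - z 1| = `|z 1 - z 2| /\ `|z 1 - z 2| = `|z 2 - z 0|.

Definition collinear_triangle (R : realType) (z : triangle R) : Prop :=
  exists p d : Cplx R, forall i, exists t : R, z i = p + t%:C%C * d.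

Definition modulus_ratio (R : realType) (z : triangle R) (i : 'Z_3) : Cplx R :=
  `|z (i - 1)| / `|z i|.

(* If z i = 0, then modulus_ratio z i = 0 by the convention x / 0 = 0; also
   modulus_ratio z (i + 1) = 0, hence triangle_step z takes equal values at i
   and i + 1. So a sequence of nondegenerate iterates never has a vertex at the
   origin and never uses this convention. *)
Definition triangle_step (R : realType) (z : triangle R) : triangle R := fun i =>
  2 / 3 * modulus_ratio z i * z i
  - 1 / 3 * modulus_ratio z (i + 1) * z (i + 1)
  - 1 / 3 * modulus_ratio z (i + 2) * z (i + 2).

Fixpoint triangle_iter (R : realType) (z : triangle R) (n : nat) : triangle R :=
  if n is m.+1 then triangle_step (triangle_iter z m) else z.

(* Main.v *)
Require Import Defs.
From mathcomp Require Import all_boot all_order all_algebra.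
From mathcomp Require Import complex.
From mathcomp Require Import all_classical all_reals all_analysis.
From mathcomp Require Import ring lra.

Set Implicit Arguments.
Unset Strict Implicit.
Unset Printing Implicit Defensive.

Import Order.TTheory GRing.Theory Num.Theory numFieldNormedType.Exports.

Local Open Scope classical_set_scope.
Local Open Scope ring_scope.

(* One step permutes the moduli m_i cyclically while keeping the directions of
   the vertices, and then moves the centroid g back to the origin.  Hence
   E = sum m_i^2 decreases (by 3 |g|^2), whereas the signed area
   S = z_i x z_(i+1), the same for all i, is multiplied by
   (m_2/m_1 + m_0/m_2 + m_1/m_0) / 3, which is >= 1 by AM-GM.  So the defect
   D = E - 2 sqrt 3 |S|, which is >= 0 and vanishes exactly on equilateral
   triangles, decreases.  By Heron's formula for the triangle with side lengths
   m_i, D is comparable to sum (m_i - m_j)^2, and so is the AM-GM gain; if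
   S <> 0 at the start this yields D' <= (1 - delta) D with a fixed delta > 0.
   As a step displaces each vertex by O(sqrt D), the vertices converge
   geometrically; the limit has defect 0 and area at least the initial one.
   If S = 0, the vertices are t u, s u, -(t + s) u with t, s > 0, a step sends
   (t, s) to (t / 3 + s, t / 3), and everything shrinks to the origin. *)

(** * Inequalities and identities over an ordered field *)

(** Divided by [x * y * z], this is AM-GM for x/y, y/z, z/x, the shape of the area factor; the
    cleared form also allows zeros. *)
Lemma cyclic_agm_ge0 (F : realFieldType) (x y z : F) : 0 <= x -> 0 <= y -> 0 <= z ->
  3 * (x * y * z) <= x ^+ 2 * z + y ^+ 2 * x + z ^+ 2 * y.
Proof.
(* By cyclic symmetry, the last variable may be taken to be the smallest. *)
have zmin (u v w : F) : 0 <= w -> w <= u -> w <= v ->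
    3 * (u * v * w) <= u ^+ 2 * w + v ^+ 2 * u + w ^+ 2 * v.
  move=> w0 wu wv; rewrite -subr_ge0.
  have -> : u ^+ 2 * w + v ^+ 2 * u + w ^+ 2 * v - 3 * (u * v * w) =
            w * (u - v) ^+ 2 + v * ((v - w) * (u - w)) by ring.
  have v0 : 0 <= v := le_trans w0 wv.
  by rewrite addr_ge0 // mulr_ge0 ?sqr_ge0 // mulr_ge0 ?subr_ge0.
move=> x0 y0 z0.
have [xy|/ltW yx] := leP x y; first have [xz|/ltW zx] := leP x z.
- by have := zmin y z x x0 xy xz; lra.
- by have := zmin x y z z0 zx (le_trans zx xy); lra.
have [yz|/ltW zy] := leP y z; first by have := zmin z x y y0 yz yx; lra.
by have := zmin x y z z0 (le_trans zy yx) zy; lra.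
Qed.

Lemma cyclic_agm_gap (F : realFieldType) (mu x y z : F) :
    mu <= x -> mu <= y -> mu <= z ->
  mu / 2 * ((x - y) ^+ 2 + (y - z) ^+ 2 + (z - x) ^+ 2) <=
  x ^+ 2 * z + y ^+ 2 * x + z ^+ 2 * y - 3 * (x * y * z).
Proof.
move=> mux muy muz.
(* Subtracting mu from the three variables changes the right-hand side by
   exactly the left-hand side. *)
have := @cyclic_agm_ge0 _ (x - mu) (y - mu) (z - mu).
by rewrite !subr_ge0 => /(_ mux muy muz); lra.
Qed.

(* The sides m_i are those of the triangle spanned by z_0 and z_1 head to tail;
   its area is half of the cross product. *)
Lemma heron_moduli (F : realFieldType) (x0 y0 x1 y1 x2 y2 : F) :
    x0 + x1 + x2 = 0 -> y0 + y1 + y2 = 0 ->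
  let q0 := x0 ^+ 2 + y0 ^+ 2 in let q1 := x1 ^+ 2 + y1 ^+ 2 in
  let q2 := x2 ^+ 2 + y2 ^+ 2 in
  2 * ((q0 - q1) ^+ 2 + (q1 - q2) ^+ 2 + (q2 - q0) ^+ 2) =
  (q0 + q1 + q2) ^+ 2 - 12 * (x0 * y1 - x1 * y0) ^+ 2.
Proof.
move=> hx hy /=.
have -> : x2 = - (x0 + x1) by lra.
have -> : y2 = - (y0 + y1) by lra.
by ring.
Qed.

(** Heron's relation says that [D * (E + 2 * s * a)] is twice the sum of the (m_i - m_j)^2 (m_i +
    m_j)^2. Here [E + 2 * s * a] lies between E and 2E, and each (m_i + m_j)^2 between E/2 and 2E,
    the lower bound by the triangle inequality. Cancelling E leaves the comparisons. *)
Lemma defect_bounds (F : realFieldType) (s a m0 m1 m2 : F) :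
    0 < s -> s ^+ 2 = 3 -> 0 <= a -> 0 < m0 -> 0 < m1 -> 0 < m2 ->
    m0 <= m1 + m2 -> m1 <= m2 + m0 -> m2 <= m0 + m1 ->
    2 * ((m0 ^+ 2 - m1 ^+ 2) ^+ 2 + (m1 ^+ 2 - m2 ^+ 2) ^+ 2
         + (m2 ^+ 2 - m0 ^+ 2) ^+ 2) =
      (m0 ^+ 2 + m1 ^+ 2 + m2 ^+ 2) ^+ 2 - 12 * a ^+ 2 ->
  let D := m0 ^+ 2 + m1 ^+ 2 + m2 ^+ 2 - 2 * s * a in
  [/\ 0 <= D,
      D <= 4 * ((m0 - m1) ^+ 2 + (m1 - m2) ^+ 2 + (m2 - m0) ^+ 2),
      (m0 - m1) ^+ 2 <= 2 * D, (m1 - m2) ^+ 2 <= 2 * D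
    & (m2 - m0) ^+ 2 <= 2 * D].
Proof.
move=> s0 s3 a0 h0 h1 h2 t0 t1 t2 heron D.
set E := m0 ^+ 2 + m1 ^+ 2 + m2 ^+ 2 in heron.
have E0 : 0 < E by rewrite /E !addr_gt0 ?exprn_gt0.
have fact : D * (E + 2 * s * a) = E ^+ 2 - 12 * a ^+ 2.
  rewrite /D -/E; have -> : 12 * a ^+ 2 = 4 * s ^+ 2 * a ^+ 2 by rewrite s3; ring.
  by ring.
have sa0 : 0 <= 2 * s * a by rewrite !mulr_ge0 // ltW.
have D0 : 0 <= D.
  have Esa : 0 < E + 2 * s * a by rewrite ltr_pwDl.
  by rewrite -(pmulr_lge0 _ Esa) fact -heron mulr_ge0 ?addr_ge0 ?sqr_ge0.
have sqD (x y : F) : (x ^+ 2 - y ^+ 2) ^+ 2 = (x - y) ^+ 2 * (x + y) ^+ 2 by ring.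
have DE : D * (E + 2 * s * a) <= 2 * D * E.
  have : 0 <= D * D by rewrite mulr_ge0.
  by rewrite /D -/E; lra.
have gap (x y z : F) : 0 < x -> 0 < y -> 0 < z -> x ^+ 2 + y ^+ 2 + z ^+ 2 = E ->
    z <= x + y -> 2 * (x ^+ 2 - y ^+ 2) ^+ 2 <= D * (E + 2 * s * a) ->
    (x - y) ^+ 2 <= 2 * D.
  move=> x0 y0 z0 eE tri hle.
  rewrite -(ler_pM2r E0).
  have xy0 : 0 < x * y by rewrite mulr_gt0.
  have zz : z ^+ 2 <= (x + y) ^+ 2 by rewrite lerXn2r // ?nnegrE ltW // addr_gt0.
  have : E <= 2 * (x + y) ^+ 2 by lra.
  move/(ler_wpM2l (sqr_ge0 (x - y))).
  by rewrite sqD in hle; lra.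
have p01 := sqr_ge0 (m0 ^+ 2 - m1 ^+ 2).
have p12 := sqr_ge0 (m1 ^+ 2 - m2 ^+ 2).
have p20 := sqr_ge0 (m2 ^+ 2 - m0 ^+ 2).
split=> //.
- rewrite -(ler_pM2r E0).
  have : D * E <= D * (E + 2 * s * a) by rewrite ler_wpM2l // lerDl.
  have up (x y z : F) : x ^+ 2 + y ^+ 2 + z ^+ 2 = E ->
      (x ^+ 2 - y ^+ 2) ^+ 2 <= (x - y) ^+ 2 * (2 * E).
    move=> eE; rewrite sqD ler_wpM2l ?sqr_ge0 //.
    have := sqr_ge0 (x - y); have := sqr_ge0 z; lra.
  have u01 := up m0 m1 m2 erefl.
  have u12 : (m1 ^+ 2 - m2 ^+ 2) ^+ 2 <= (m1 - m2) ^+ 2 * (2 * E).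
    by apply: (up _ _ m0); rewrite /E; ring.
  have u20 : (m2 ^+ 2 - m0 ^+ 2) ^+ 2 <= (m2 - m0) ^+ 2 * (2 * E).
    by apply: (up _ _ m1); rewrite /E; ring.
  rewrite fact -heron; lra.
- by apply: (gap _ _ m2); rewrite ?fact -?heron //; lra.
- by apply: (gap _ _ m0); rewrite ?fact -?heron // /E; lra.
- by apply: (gap _ _ m1); rewrite ?fact -?heron // /E; lra.
Qed.

Lemma step_energy (F : realFieldType) (x0 y0 x1 y1 x2 y2 m0 m1 m2 : F) :
    m0 != 0 -> m1 != 0 -> m2 != 0 ->
    m0 ^+ 2 = x0 ^+ 2 + y0 ^+ 2 -> m1 ^+ 2 = x1 ^+ 2 + y1 ^+ 2 ->
    m2 ^+ 2 = x2 ^+ 2 + y2 ^+ 2 ->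
  let r0 := m2 / m0 in let r1 := m0 / m1 in let r2 := m1 / m2 in
  let x0' := 2 / 3 * r0 * x0 - 1 / 3 * r1 * x1 - 1 / 3 * r2 * x2 in
  let x1' := 2 / 3 * r1 * x1 - 1 / 3 * r2 * x2 - 1 / 3 * r0 * x0 in
  let x2' := 2 / 3 * r2 * x2 - 1 / 3 * r0 * x0 - 1 / 3 * r1 * x1 in
  let y0' := 2 / 3 * r0 * y0 - 1 / 3 * r1 * y1 - 1 / 3 * r2 * y2 in
  let y1' := 2 / 3 * r1 * y1 - 1 / 3 * r2 * y2 - 1 / 3 * r0 * y0 in
  let y2' := 2 / 3 * r2 * y2 - 1 / 3 * r0 * y0 - 1 / 3 * r1 * y1 in
  (x0' ^+ 2 + y0' ^+ 2) + (x1' ^+ 2 + y1' ^+ 2) + (x2' ^+ 2 + y2' ^+ 2) <=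
  (x0 ^+ 2 + y0 ^+ 2) + (x1 ^+ 2 + y1 ^+ 2) + (x2 ^+ 2 + y2 ^+ 2).
Proof.
move=> h0 h1 h2 e0 e1 e2 /=.
set r0 := m2 / m0; set r1 := m0 / m1; set r2 := m1 / m2.
have q0 : r0 ^+ 2 * (x0 ^+ 2 + y0 ^+ 2) = m2 ^+ 2 by rewrite -e0 /r0; field.
have q1 : r1 ^+ 2 * (x1 ^+ 2 + y1 ^+ 2) = m0 ^+ 2 by rewrite -e1 /r1; field.
have q2 : r2 ^+ 2 * (x2 ^+ 2 + y2 ^+ 2) = m1 ^+ 2 by rewrite -e2 /r2; field.
(* The energy lost is 3 |g|^2, a third of the sum of these two squares. *)
have gx := sqr_ge0 (r0 * x0 + r1 * x1 + r2 * x2).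
have gy := sqr_ge0 (r0 * y0 + r1 * y1 + r2 * y2).
rewrite -e0 -e1 -e2; lra.
Qed.

(** With w_i = r_i z_i and g their centroid, (w_0 - g) x (w_1 - g) is the mean of the three products
    w_i x w_(i+1). Each of these is r_i r_(i+1) S, and r_i r_(i+1) telescopes to a single quotient
    of moduli. *)
Lemma step_cross (F : realFieldType) (x0 y0 x1 y1 x2 y2 m0 m1 m2 : F) :
    m0 != 0 -> m1 != 0 -> m2 != 0 ->
    x0 + x1 + x2 = 0 -> y0 + y1 + y2 = 0 ->
  let r0 := m2 / m0 in let r1 := m0 / m1 in let r2 := m1 / m2 in
  let x0' := 2 / 3 * r0 * x0 - 1 / 3 * r1 * x1 - 1 / 3 * r2 * x2 in
  let x1' := 2 / 3 * r1 * x1 - 1 / 3 * r2 * x2 - 1 / 3 * r0 * x0 in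
  let y0' := 2 / 3 * r0 * y0 - 1 / 3 * r1 * y1 - 1 / 3 * r2 * y2 in
  let y1' := 2 / 3 * r1 * y1 - 1 / 3 * r2 * y2 - 1 / 3 * r0 * y0 in
  x0' * y1' - x1' * y0' =
  (m2 / m1 + m0 / m2 + m1 / m0) / 3 * (x0 * y1 - x1 * y0).
Proof.
move=> h0 h1 h2 hx hy /=.
have -> : x2 = - (x0 + x1) by lra.
have -> : y2 = - (y0 + y1) by lra.
by field; rewrite h0 h1 h2.
Qed.

(** The defect drops by at least 2s(a' - a). The AM-GM gain bounds a' - a below by c/(3 L^3) times
    (mu/2) G, and G >= D/4; the product of these constants is the contraction rate. *)
Lemma defect_contraction (F : realFieldType) (s c E E' a a' mu L m0 m1 m2 : F) :
    0 < s -> 0 <= c -> c <= a -> 0 < mu -> mu <= m0 -> mu <= m1 -> mu <= m2 ->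
    m0 <= L -> m1 <= L -> m2 <= L ->
    a' = (m2 / m1 + m0 / m2 + m1 / m0) / 3 * a -> E' <= E ->
    E - 2 * s * a <= 4 * ((m0 - m1) ^+ 2 + (m1 - m2) ^+ 2 + (m2 - m0) ^+ 2) ->
  a <= a' /\
  (0 <= E - 2 * s * a ->
   E' - 2 * s * a' <= (1 - s * c * mu / (12 * L ^+ 3)) * (E - 2 * s * a)).
Proof.
move=> s0 c0 ca mu0 mu_m0 mu_m1 mu_m2 m0L m1L m2L ea' EE' DG.
have m0_gt0 := lt_le_trans mu0 mu_m0.
have m1_gt0 := lt_le_trans mu0 mu_m1.
have m2_gt0 := lt_le_trans mu0 mu_m2.
have L0 := lt_le_trans m0_gt0 m0L.
set G := _ + _ + _ in DG; set D := E - _ in DG *.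
have G0 : 0 <= G by rewrite /G !addr_ge0 ?sqr_ge0.
have a0 := le_trans c0 ca.
set p := m0 * m1 * m2.
have p0 : 0 < p by rewrite /p !mulr_gt0.
have pL : p <= L ^+ 3.
  rewrite /p !exprS expr0 mulr1 mulrA.
  by rewrite !ler_pM ?mulr_ge0 // ltW.
have gain : a' - a = a / 3 / p *
    (m2 ^+ 2 * m0 + m1 ^+ 2 * m2 + m0 ^+ 2 * m1 - 3 * (m2 * m1 * m0)).
  by rewrite ea' /p; field; rewrite !gt_eqF.
have lower : c / 3 / L ^+ 3 * (mu / 2 * G) <= a' - a.
  rewrite gain; apply: ler_pM.
  - by rewrite !mulr_ge0 ?invr_ge0 ?exprn_ge0 // ltW.
  - by rewrite !mulr_ge0 // ?invr_ge0 // ltW.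
  - apply: ler_pM; rewrite ?mulr_ge0 ?invr_ge0 ?exprn_ge0 ?(ltW L0) //.
    + by rewrite ler_pM2r // invr_gt0.
    + by rewrite lef_pV2 // posrE exprn_gt0.
  - by have := cyclic_agm_gap mu_m2 mu_m1 mu_m0; rewrite /G; lra.
have k0 : 0 <= c / 3 / L ^+ 3 * (mu / 2).
  by rewrite !mulr_ge0 ?invr_ge0 ?exprn_ge0 // ltW.
split; first by have := mulr_ge0 k0 G0; lra.
move=> D0.
have : c / 3 / L ^+ 3 * (mu / 2) * (D / 4) <= a' - a.
  by have := ler_wpM2l k0 (_ : D / 4 <= G); lra.
move/(ler_wpM2l (ltW s0)).
have -> : s * (c / 3 / L ^+ 3 * (mu / 2) * (D / 4)) =
   s * c * mu / (12 * L ^+ 3) * D / 2 by field; rewrite gt_eqF.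
by rewrite mulrBl mul1r {2}/D; lra.
Qed.

(** * Indices modulo 3, moduli and real coordinates *)

Lemma ord3_pred : ((0 - 1 = 2 :> 'Z_3)%R * (1 - 1 = 0 :> 'Z_3)%R * (2 - 1 = 1 :> 'Z_3)%R)%type.
Proof. by do !split; apply/val_inj. Qed.

Lemma ord3_add : ((0 + 1 = 1 :> 'Z_3)%R * (1 + 1 = 2 :> 'Z_3)%R * (2 + 1 = 0 :> 'Z_3)%R
  * (0 + 2 = 2 :> 'Z_3)%R * (1 + 2 = 0 :> 'Z_3)%R * (2 + 2 = 1 :> 'Z_3)%R)%type.
Proof. by do !split; apply/val_inj. Qed.

Lemma forall_Z3 (P : 'Z_3 -> Prop) : P 0 -> P 1 -> P 2 -> forall i, P i.
Proof.
move=> P0 P1 P2 [[|[|[|//]]] lt_i].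
- by rewrite (_ : Ordinal _ = 0) //; apply/val_inj.
- by rewrite (_ : Ordinal _ = 1) //; apply/val_inj.
- by rewrite (_ : Ordinal _ = 2) //; apply/val_inj.
Qed.

Lemma cvg_Cplx (R : realType) (u : nat -> Cplx R) (l : Cplx R) :
  complex.Re (u n) @[n --> \oo] --> complex.Re l ->
  complex.Im (u n) @[n --> \oo] --> complex.Im l ->
  u n @[n --> \oo] --> l.
Proof.
move=> /cvgrPdist_lt cRe /cvgrPdist_lt cIm; apply/cvgrPdist_lt => e.
(* A positive element of [Cplx R] has imaginary part 0; half of its real part is the tolerance for
   each coordinate. *)
rewrite ltcE /= => /andP[/eqP ime ree].
have e2 : 0 < complex.Re e / 2 by rewrite divr_gt0.
have := cIm _ e2; have := cRe _ e2.
apply: filterS2 => n hRe hIm.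
have -> : l - u n = (complex.Re l - complex.Re (u n))%:C%C
    + 'i%C * (complex.Im l - complex.Im (u n))%:C%C.
  by rewrite [in LHS](complexE l) [in LHS](complexE (u n)) !rmorphB /=; ring.
apply: (le_lt_trans (ler_normD _ _)).
rewrite normrM !normc_def.
rewrite /= expr0n expr1n /= add0r !addr0 sqrtr1 mul1r !sqrtr_sqr -rmorphD ltcE /= ime eqxx /=.
by rewrite [ltRHS]splitr ltrD.
Qed.

(** The norm on [Cplx R] takes values in [Cplx R]; this is its real-valued counterpart. *)
Definition modulus (R : realType) (z : triangle R) (i : 'Z_3) : R :=
  Num.sqrt (complex.Re (z i) ^+ 2 + complex.Im (z i) ^+ 2).

Lemma norm_modulus (R : realType) (z : triangle R) i : `|z i| = (modulus z i)%:C%C.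
Proof. by rewrite normc_def. Qed.

Lemma sqr_modulus (R : realType) (z : triangle R) i :
  modulus z i ^+ 2 = complex.Re (z i) ^+ 2 + complex.Im (z i) ^+ 2.
Proof. by rewrite sqr_sqrtr // addr_ge0 // sqr_ge0. Qed.

Lemma modulus_gt0 (R : realType) (z : triangle R) i : (0 < modulus z i) = (z i != 0).
Proof. by rewrite -ltcR -norm_modulus normr_gt0. Qed.

Lemma ReMr (R : realType) (a : R) (w : Cplx R) :
  complex.Re (a%:C%C * w) = a * complex.Re w.
Proof. by case: w => x y /=; rewrite mul0r subr0. Qed.

Lemma ImMr (R : realType) (a : R) (w : Cplx R) :
  complex.Im (a%:C%C * w) = a * complex.Im w.
Proof. by case: w => x y /=; rewrite mul0r addr0. Qed.

Lemma triangle_stepE (R : realType) (z : triangle R) i :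
  let r j := modulus z (j - 1) / modulus z j in
  triangle_step z i = (2 / 3 * r i)%:C%C * z i - (1 / 3 * r (i + 1))%:C%C * z (i + 1)
    - (1 / 3 * r (i + 2))%:C%C * z (i + 2).
Proof.
rewrite /= /triangle_step /modulus_ratio !norm_modulus.
by rewrite !rmorphM /= !fmorphV /= !rmorph1 !rmorph_nat.
Qed.

Lemma Re_triangle_step (R : realType) (z : triangle R) i :
  let r j := modulus z (j - 1) / modulus z j in
  complex.Re (triangle_step z i) = 2 / 3 * r i * complex.Re (z i)
    - 1 / 3 * r (i + 1) * complex.Re (z (i + 1))
    - 1 / 3 * r (i + 2) * complex.Re (z (i + 2)).
Proof. by rewrite triangle_stepE !raddfB /= !ReMr. Qed.

Lemma Im_triangle_step (R : realType) (z : triangle R) i :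
  let r j := modulus z (j - 1) / modulus z j in
  complex.Im (triangle_step z i) = 2 / 3 * r i * complex.Im (z i)
    - 1 / 3 * r (i + 1) * complex.Im (z (i + 1))
    - 1 / 3 * r (i + 2) * complex.Im (z (i + 2)).
Proof. by rewrite triangle_stepE !raddfB /= !ImMr. Qed.

(** * Energy, cross product and defect of a centred triangle *)

Definition centered (R : realType) (z : triangle R) : Prop :=
  z 0 + z 1 + z 2 = 0.

Lemma centered_triangle_step (R : realType) (z : triangle R) :
  centered (triangle_step z).
Proof.
by rewrite /centered /triangle_step !ord3_add; field; rewrite ?pnatr_eq0.
Qed.

Lemma centered_coord (R : realType) (z : triangle R) : centered z ->
  complex.Re (z 0) + complex.Re (z 1) + complex.Re (z 2) = 0 /\
  complex.Im (z 0) + complex.Im (z 1) + complex.Im (z 2) = 0.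
Proof. by move=> z0; rewrite -!raddfD z0. Qed.

Definition energy (R : realType) (z : triangle R) : R :=
  modulus z 0 ^+ 2 + modulus z 1 ^+ 2 + modulus z 2 ^+ 2.

(** In a centred triangle the products z_i x z_(i+1) coincide, so one pair represents all; the
    signed area of the triangle is 3/2 of it. *)
Definition cross (R : realType) (z : triangle R) : R :=
  complex.Re (z 0) * complex.Im (z 1) - complex.Re (z 1) * complex.Im (z 0).

Definition defect (R : realType) (z : triangle R) : R :=
  energy z - 2 * Num.sqrt 3 * `|cross z|.

Lemma energy_triangle_step (R : realType) (z : triangle R) :
  (forall i, z i != 0) -> energy (triangle_step z) <= energy z.
Proof.
move=> znz; have mnz i : modulus z i != 0 by rewrite gt_eqF // modulus_gt0.
rewrite /energy !sqr_modulus !Re_triangle_step !Im_triangle_step !ord3_add !ord3_pred.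
exact: step_energy (mnz 0) (mnz 1) (mnz 2) (sqr_modulus _ _) (sqr_modulus _ _)
  (sqr_modulus _ _).
Qed.

Lemma cross_triangle_step (R : realType) (z : triangle R) :
    centered z -> (forall i, z i != 0) ->
  `|cross (triangle_step z)| =
  (modulus z 2 / modulus z 1 + modulus z 0 / modulus z 2
   + modulus z 1 / modulus z 0) / 3 * `|cross z|.
Proof.
move=> /centered_coord[zx zy] znz.
have m_gt0 i : 0 < modulus z i by rewrite modulus_gt0.
have mnz i : modulus z i != 0 by rewrite gt_eqF.
rewrite /cross !Re_triangle_step !Im_triangle_step !ord3_add !ord3_pred.
rewrite (step_cross (mnz 0) (mnz 1) (mnz 2) zx zy) normrM ger0_norm //.
by rewrite divr_ge0 // !addr_ge0 ?divr_ge0 // ltW.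
Qed.

Lemma energy_defect_bounds (R : realType) (z : triangle R) :
    centered z -> (forall i, z i != 0) ->
  [/\ 0 <= defect z,
      defect z <= 4 * ((modulus z 0 - modulus z 1) ^+ 2
        + (modulus z 1 - modulus z 2) ^+ 2 + (modulus z 2 - modulus z 0) ^+ 2)
    & forall i, (modulus z (i - 1) - modulus z i) ^+ 2 <= 2 * defect z].
Proof.
move=> zc znz; have [zx zy] := centered_coord zc.
have m_gt0 i : 0 < modulus z i by rewrite modulus_gt0.
(* Each vertex of a centred triangle is minus the sum of the other two, so the moduli satisfy the
   triangle inequalities. *)
have tri i j k : z i = - (z j + z k) -> modulus z i <= modulus z j + modulus z k.
  by move=> e; rewrite -lecR rmorphD /= -!norm_modulus e normrN ler_normD.
have s3_gt0 : 0 < Num.sqrt 3 :> R by rewrite sqrtr_gt0.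
have s3_sqr : Num.sqrt 3 ^+ 2 = 3 :> R by rewrite sqr_sqrtr.
have := @defect_bounds _ (Num.sqrt 3) `|cross z|
  (modulus z 0) (modulus z 1) (modulus z 2) s3_gt0 s3_sqr (normr_ge0 _)
  (m_gt0 0) (m_gt0 1) (m_gt0 2).
case.
- by apply: tri; apply/eqP; rewrite -subr_eq0 opprK addrA; apply/eqP.
- by apply: tri; apply/eqP; rewrite -subr_eq0 opprK addrA addrC addrA; apply/eqP.
- by apply: tri; apply/eqP; rewrite -subr_eq0 opprK addrC; apply/eqP.
- by rewrite real_normK ?num_real // !sqr_modulus; exact: heron_moduli.
move=> D0 D4 D01 D12 D20; split=> //.
by apply: forall_Z3; rewrite ord3_pred // sqrrB; move: D20; rewrite sqrrB.
Qed.

(** * Displacement of the vertices in one step *)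

Lemma cvg_of_geometric_increments (R : realType) (u : nat -> R) (C q : R) :
    0 <= q -> q < 1 -> (forall n, `|u n.+1 - u n| <= C * q ^+ n) -> cvgn u.
Proof.
move=> q0 q1 uC.
have C0 : 0 <= C by have := le_trans (normr_ge0 _) (uC 0%N); rewrite expr0 mulr1.
suff : cvgn (series (telescope u)).
  move=> cs; rewrite (_ : u = (fun=> u 0%N) \+ series (telescope u)).
    by apply: is_cvgD => //; exact: is_cvg_cst.
  by apply/funext => n /=; exact: eq_sum_telescope.
apply: normed_cvg; apply: (@series_le_cvg _ _ (geometric C q)).
- by move=> n /=; exact: normr_ge0.
- by move=> n /=; rewrite mulr_ge0 // exprn_ge0.
- by move=> n /=; exact: uC.
- by apply: is_cvg_geometric_series; rewrite ger0_norm.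
Qed.

(** Rescaling a vector from modulus [b] to modulus [a] moves each coordinate [x] by at most |a -
    b|. *)
Lemma ratio_displacement (F : realFieldType) (a b x h : F) :
  0 < b -> `|x| <= b -> 0 <= h -> (a - b) ^+ 2 <= h ^+ 2 -> `|a / b * x - x| <= h.
Proof.
move=> b0 xb h0 abh.
have -> : a / b * x - x = (a - b) * (x / b) by field; rewrite gt_eqF.
rewrite normrM -[leRHS]mulr1 ler_pM //.
  by rewrite -(@ler_pXn2r _ 2) ?nnegrE // real_normK ?num_real.
by rewrite normrM normfV (gtr0_norm b0) ler_pdivrMr // mul1r.
Qed.

Lemma triangle_step_displacement (R : realType) (z : triangle R) i :
    centered z -> (forall j, z j != 0) ->
  `|complex.Re (triangle_step z i) - complex.Re (z i)| <= 2 * Num.sqrt (2 * defect z)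
  /\ `|complex.Im (triangle_step z i) - complex.Im (z i)| <= 2 * Num.sqrt (2 * defect z).
Proof.
move=> zc znz; have [zx zy] := centered_coord zc.
have m_gt0 j : 0 < modulus z j by rewrite modulus_gt0.
have [D0 _ gap] := energy_defect_bounds zc znz.
set h := Num.sqrt _; have h0 : 0 <= h by exact: sqrtr_ge0.
have hgap j : (modulus z (j - 1) - modulus z j) ^+ 2 <= h ^+ 2.
  by rewrite sqr_sqrtr ?mulr_ge0.
have dx j : `|modulus z (j - 1) / modulus z j * complex.Re (z j) - complex.Re (z j)| <= h.
  by apply: ratio_displacement => //; rewrite /modulus -sqrtr_sqr ler_wsqrtr // lerDl sqr_ge0.
have dy j : `|modulus z (j - 1) / modulus z j * complex.Im (z j) - complex.Im (z j)| <= h.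
  by apply: ratio_displacement => //; rewrite /modulus -sqrtr_sqr ler_wsqrtr // lerDr sqr_ge0.
(* Since the x_j sum to 0, the left-hand side is the same combination of the errors w_j - x_j, hence
   at most 4h/3. *)
have comb (x0 x1 x2 w0 w1 w2 : R) : x0 + x1 + x2 = 0 -> `|w0 - x0| <= h ->
    `|w1 - x1| <= h -> `|w2 - x2| <= h ->
    `|2 / 3 * w0 - 1 / 3 * w1 - 1 / 3 * w2 - x0| <= 2 * h.
  by move=> e; rewrite !ler_norml => /andP[? ?] /andP[? ?] /andP[? ?]; apply/andP; split; lra.
have sum3 (f : 'Z_3 -> R) : f 0 + f 1 + f 2 = 0 -> f i + f (i + 1) + f (i + 2) = 0.
  by move: i; apply: forall_Z3; rewrite !ord3_add => //; lra.
have assoc (a0 a1 a2 b0 b1 b2 : R) : 2 / 3 * a0 * b0 - 1 / 3 * a1 * b1 - 1 / 3 * a2 * b2 =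
    2 / 3 * (a0 * b0) - 1 / 3 * (a1 * b1) - 1 / 3 * (a2 * b2) by ring.
rewrite Re_triangle_step Im_triangle_step !assoc; split.
- by apply: comb (dx i) (dx (i + 1)) (dx (i + 2)); exact: (sum3 (fun j => complex.Re (z j))).
- by apply: comb (dy i) (dy (i + 1)) (dy (i + 2)); exact: (sum3 (fun j => complex.Im (z j))).
Qed.

(** * Consequences of zero defect, nonzero area and bounded energy *)

(** With zero defect Heron's formula forces equal moduli. Equal sides follow from the parallelogram
    law |z_i - z_j|^2 = 2 m_i^2 + 2 m_j^2 - m_k^2. *)
Lemma defect0_equilateral (R : realType) (z : triangle R) :
  centered z -> defect z = 0 -> equilateral_triangle z.
Proof.
move=> /centered_coord[zx zy] /eqP; rewrite subr_eq0 => /eqP D0.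
have := heron_moduli zx zy; rewrite /= -!sqr_modulus -/(energy z) D0.
have -> : (2 * Num.sqrt 3 * `|cross z|) ^+ 2 = 12 * cross z ^+ 2.
  by rewrite !exprMn sqr_sqrtr // real_normK ?num_real //; ring.
rewrite subrr => /eqP; rewrite mulf_eq0 pnatr_eq0 /= !paddr_eq0 ?addr_ge0 ?sqr_ge0 //.
rewrite !sqrf_eq0 !subr_eq0 => /andP[/andP[/eqP q01 /eqP q12] _].
rewrite !sqr_modulus in q01 q12.
have x2 : complex.Re (z 2) = - (complex.Re (z 0) + complex.Re (z 1)) by lra.
have y2 : complex.Im (z 2) = - (complex.Im (z 0) + complex.Im (z 1)) by lra.
rewrite x2 y2 in q12.
by rewrite /equilateral_triangle !normc_def !raddfB /= x2 y2; split;
  congr ((Num.sqrt _)%:C%C); lra.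
Qed.

(** If two vertices of a centred triangle coincide, the third is -2 times them, so all three are
    parallel. *)
Lemma cross_neq0_nondegenerate (R : realType) (z : triangle R) :
  centered z -> cross z != 0 -> nondegenerate_triangle z.
Proof.
move=> zc S0; have [zx zy] := centered_coord zc.
have x2 : complex.Re (z 2) = - (complex.Re (z 0) + complex.Re (z 1)) by lra.
have y2 : complex.Im (z 2) = - (complex.Im (z 0) + complex.Im (z 1)) by lra.
have n01 : z 0 != z 1.
  by apply: contra S0 => /eqP e; rewrite /cross e subrr.
have n12 : z 1 != z 2.
  apply: contra S0 => /eqP e; move: x2 y2; rewrite /cross -e => x2 y2.
  have -> : complex.Re (z 0) = - 2 * complex.Re (z 1) by lra.
  have -> : complex.Im (z 0) = - 2 * complex.Im (z 1) by lra.
  by apply/eqP; ring.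
have n02 : z 0 != z 2.
  apply: contra S0 => /eqP e; move: x2 y2; rewrite /cross -e => x2 y2.
  have -> : complex.Re (z 1) = - 2 * complex.Re (z 0) by lra.
  have -> : complex.Im (z 1) = - 2 * complex.Im (z 0) by lra.
  by apply/eqP; ring.
by apply: forall_Z3; apply: forall_Z3; rewrite ?eqxx // => _; rewrite // eq_sym.
Qed.

Lemma modulus_lower_bound (R : realType) (z : triangle R) (L : R) i :
  centered z -> 0 < L -> energy z <= L ^+ 2 -> `|cross z| / L <= modulus z i.
Proof.
move=> /centered_coord[zx zy] L0 EL.
rewrite ler_pdivrMr // -(@ler_pXn2r _ 2) ?nnegrE ?mulr_ge0 ?sqrtr_ge0 ?(ltW L0) //.
rewrite real_normK ?num_real // exprMn.
apply: (@le_trans _ _ (modulus z i ^+ 2 * energy z)); last first.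
  by rewrite ler_wpM2l ?sqr_ge0.
have m0 := sqr_ge0 (modulus z 0); have m1 := sqr_ge0 (modulus z 1).
have m2 := sqr_ge0 (modulus z 2).
(* Lagrange's identity: the two sides differ by the square of the inner product. *)
have S01 : cross z ^+ 2 <= modulus z 0 ^+ 2 * modulus z 1 ^+ 2.
  rewrite !sqr_modulus /cross.
  have := sqr_ge0 (complex.Re (z 0) * complex.Re (z 1) + complex.Im (z 0) * complex.Im (z 1)).
  by lra.
have S12 : cross z ^+ 2 <= modulus z 1 ^+ 2 * modulus z 2 ^+ 2.
  rewrite !sqr_modulus /cross.
  have -> : complex.Re (z 0) = - (complex.Re (z 1) + complex.Re (z 2)) by lra.
  have -> : complex.Im (z 0) = - (complex.Im (z 1) + complex.Im (z 2)) by lra.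
  have := sqr_ge0 (complex.Re (z 1) * complex.Re (z 2) + complex.Im (z 1) * complex.Im (z 2)).
  by lra.
have p00 := mulr_ge0 m0 m0; have p11 := mulr_ge0 m1 m1; have p22 := mulr_ge0 m2 m2.
have p01 := mulr_ge0 m0 m1; have p12 := mulr_ge0 m1 m2; have p02 := mulr_ge0 m0 m2.
by move: i; apply: forall_Z3; rewrite /energy; lra.
Qed.

Lemma modulus_upper_bound (R : realType) (z : triangle R) (L : R) i :
  0 < L -> energy z <= L ^+ 2 -> modulus z i <= L.
Proof.
move=> L0 EL; rewrite -(@ler_pXn2r _ 2) ?nnegrE ?sqrtr_ge0 ?(ltW L0) //.
apply: le_trans EL; rewrite /energy.
have m0 := sqr_ge0 (modulus z 0); have m1 := sqr_ge0 (modulus z 1).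
have m2 := sqr_ge0 (modulus z 2).
by move: i; apply: forall_Z3; lra.
Qed.

(** * Convergence from a triangle of nonzero area *)

Lemma centered_triangle_iter (R : realType) (z : triangle R) n :
  centered z -> centered (triangle_iter z n).
Proof. by case: n => // n _; exact: centered_triangle_step. Qed.

(** Energy never grows and |S| never shrinks, so every iterate has its moduli in [c/L, L], where L^2
    is the initial energy. One contraction factor therefore serves for all n. *)
Lemma defect_geometric (R : realType) (z : triangle R) :
    centered z -> cross z != 0 -> (forall n i, triangle_iter z n i != 0) ->
  exists2 q : R, 0 <= q < 1 & forall n,
    defect (triangle_iter z n) <= q ^+ n * defect z /\
    `|cross z| <= `|cross (triangle_iter z n)|.
Proof.
move=> zc S0 znz.
set c := `|cross z|; have c0 : 0 < c by rewrite normr_gt0.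
have m_gt0 i : 0 < modulus z i by rewrite modulus_gt0 (znz 0%N).
have E0 : 0 < energy z by rewrite !addr_gt0 ?exprn_gt0.
set L := Num.sqrt (energy z); have L0 : 0 < L by rewrite sqrtr_gt0.
have L2 : L ^+ 2 = energy z by rewrite sqr_sqrtr // ltW.
have s0 : 0 < Num.sqrt 3 :> R by rewrite sqrtr_gt0.
(* The rate from [defect_contraction] with mu = c/L. *)
set delta : R := Num.sqrt 3 * c * (c / L) / (12 * L ^+ 3).
have delta0 : 0 < delta by rewrite !(divr_gt0, mulr_gt0) ?exprn_gt0.
exists (Num.max (1 - delta) 0).
  by rewrite le_max lexx orbT /= gt_max ltr01 andbT; lra.
set q := Num.max _ _.
have q0 : 0 <= q by rewrite le_max lexx orbT.
suff inv n : [/\ energy (triangle_iter z n) <= L ^+ 2,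
    defect (triangle_iter z n) <= q ^+ n * defect z
    & c <= `|cross (triangle_iter z n)|].
  by move=> n; have [] := inv n.
elim: n => [|n [EL DL cS]]; first by rewrite expr0 mul1r L2.
set w := triangle_iter z n in EL DL cS *.
have wc : centered w by exact: centered_triangle_iter.
have wnz i : w i != 0 by exact: znz.
have [D0 D4 _] := energy_defect_bounds wc wnz.
have Ew := energy_triangle_step wnz.
have lo i : c / L <= modulus w i.
  by apply: le_trans (modulus_lower_bound i wc L0 EL); rewrite ler_pM2r ?invr_gt0.
have hi i := modulus_upper_bound i L0 EL.
have [mono contr] := defect_contraction s0 (ltW c0) cS (divr_gt0 c0 L0)
  (lo 0) (lo 1) (lo 2) (hi 0) (hi 1) (hi 2) (cross_triangle_step wc wnz) Ew D4.
split; first exact: le_trans Ew EL; last exact: le_trans cS mono.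
apply: (le_trans (contr D0)); rewrite [q ^+ _]exprS -[leRHS]mulrA.
apply: (@le_trans _ _ (q * defect w)); last by rewrite ler_wpM2l.
by rewrite ler_wpM2r // le_max lexx.
Qed.

Lemma noncollinear_limit (R : realType) (z : triangle R) :
    centered z -> cross z != 0 -> (forall n i, triangle_iter z n i != 0) ->
  exists l : triangle R,
    [/\ equilateral_triangle l,
        forall i, triangle_iter z n i @[n --> \oo] --> l i
      & nondegenerate_triangle l].
Proof.
move=> zc S0 znz; have [q /andP[q0 q1] Dq] := defect_geometric zc S0 znz.
pose Z := triangle_iter z.
have Zc n : centered (Z n) by exact: centered_triangle_iter.
have D0 n : 0 <= defect (Z n) by have [] := energy_defect_bounds (Zc n) (znz n).
have sq0 : 0 <= Num.sqrt q by exact: sqrtr_ge0.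
have sq1 : Num.sqrt q < 1 by rewrite -sqrtr1 ltr_sqrt.
(* Displacements are of order the square root of the defect, so they decay with ratio
   [Num.sqrt q]. *)
pose C : R := 2 * Num.sqrt (2 * defect z).
have stepC n : 2 * Num.sqrt (2 * defect (Z n)) <= C * Num.sqrt q ^+ n.
  have -> : Num.sqrt q ^+ n = Num.sqrt (q ^+ n).
    by elim: n => [|n IH]; rewrite ?expr0 ?sqrtr1 // !exprS IH sqrtrM.
  rewrite /C -mulrA ler_pM2l // -sqrtrM ?mulr_ge0 ?(D0 0%N) //.
  rewrite ler_sqrt ?mulr_ge0 ?(D0 0%N) ?exprn_ge0 //.
  by have [DL _] := Dq n; rewrite -mulrA ler_pM2l // [leRHS]mulrC.
have cRe i : cvgn (fun n => complex.Re (Z n i)).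
  apply: (@cvg_of_geometric_increments _ _ C (Num.sqrt q)) => // n.
  by apply: le_trans (stepC n); have [] := triangle_step_displacement i (Zc n) (znz n).
have cIm i : cvgn (fun n => complex.Im (Z n i)).
  apply: (@cvg_of_geometric_increments _ _ C (Num.sqrt q)) => // n.
  by apply: le_trans (stepC n); have [] := triangle_step_displacement i (Zc n) (znz n).
pose l : triangle R := fun i =>
  Complex (limn (fun n => complex.Re (Z n i))) (limn (fun n => complex.Im (Z n i))).
have lRe i : complex.Re (Z n i) @[n --> \oo] --> complex.Re (l i) by exact: cRe.
have lIm i : complex.Im (Z n i) @[n --> \oo] --> complex.Im (l i) by exact: cIm.
have lc : centered l.
  have sum0 (f : 'Z_3 -> nat -> R) (a : 'Z_3 -> R) :
      (forall i, f i n @[n --> \oo] --> a i) ->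
      (forall n, f 0 n + f 1 n + f 2 n = 0) -> a 0 + a 1 + a 2 = 0.
    move=> fa f0.
    have fsum : f 0 n + f 1 n + f 2 n @[n --> \oo] --> a 0 + a 1 + a 2.
      by apply: cvgD; [apply: cvgD|]; exact: fa.
    rewrite -(cvg_lim (@Rhausdorff R) fsum); apply: cvg_lim => //.
    by under eq_fun do rewrite f0; exact: cvg_cst.
  have sx := sum0 _ _ lRe (fun n => (centered_coord (Zc n)).1).
  have sy := sum0 _ _ lIm (fun n => (centered_coord (Zc n)).2).
  apply/eqP; rewrite eq_complex !raddfD /=.
  by apply/andP; split; apply/eqP; [exact: sx | exact: sy].
have lmod i : modulus (Z n) i ^+ 2 @[n --> \oo] --> modulus l i ^+ 2.
  rewrite sqr_modulus; under eq_fun do rewrite sqr_modulus.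
  by apply: cvgD; rewrite expr2; under eq_fun do rewrite expr2; apply: cvgM.
have lcross : `|cross (Z n)| @[n --> \oo] --> `|cross l|.
  by apply: cvg_norm; apply: cvgB; apply: cvgM.
have ldef : defect (Z n) @[n --> \oo] --> defect l.
  apply: cvgB; first by apply: cvgD; [apply: cvgD|].
  by apply: cvgM => //; exact: cvg_cst.
have ldef0 : defect (Z n) @[n --> \oo] --> (0 : R).
  apply: (@squeeze_cvgr _ _ _ _ (fun=> 0) (geometric (defect z) q)).
  - by near=> n; rewrite D0 /= mulrC; have [] := Dq n.
  - exact: cvg_cst.
  - by apply: cvg_geometric; rewrite ger0_norm.
exists l; split.
- exact: defect0_equilateral lc (etrans (esym (cvg_lim (@Rhausdorff R) ldef))
    (cvg_lim (@Rhausdorff R) ldef0)).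
- by move=> i; exact: cvg_Cplx.
(* The bound |S_n| >= |S_0| > 0 passes to the limit, which excludes a collapse. *)
- apply: cross_neq0_nondegenerate => //; rewrite -normr_gt0.
  apply: (@lt_le_trans _ _ `|cross z|); first by rewrite normr_gt0.
  rewrite -(cvg_lim _ lcross) //; apply: limr_ge; first by apply/cvg_ex; exists `|cross l|.
  by near=> n; have [] := Dq n.
Unshelve. all: by end_near.
Qed.

(** * No vertex at the origin *)

(** If z_i = 0, the rescaled vectors at i and i + 1 both vanish, the latter because the numerator of
    its ratio is |z_i|; the new vertices at i and i + 1 then coincide. *)
Lemma nondegenerate_step_neq0 (R : realType) (z : triangle R) i :
  nondegenerate_triangle (triangle_step z) -> z i != 0.
Proof.
move=> nd; apply/negP => /eqP zi.
have i1 : i != i + 1 by move: i {zi}; apply: forall_Z3.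
have i12 : i + 1 + 1 = i + 2 by move: i {zi i1}; apply: forall_Z3; apply/val_inj.
have i10 : i + 1 + 2 = i by move: i {zi i1 i12}; apply: forall_Z3; apply/val_inj.
move: (nd _ _ i1) => /eqP; apply.
rewrite /triangle_step /modulus_ratio i12 i10 addrK zi normr0 !mul0r !mulr0 !mul0r.
by rewrite !subr0.
Qed.

(** * Collinear triangles shrink to the origin *)

(** For positive [t] and [s], the index [k] marks the vertex that is alone on its side of the
    origin. *)
Definition flat_at (R : realType) (z : triangle R) (k : 'Z_3) (u : Cplx R) (t s : R) :=
  [/\ z k = (- (t + s))%:C%C * u, z (k + 1) = t%:C%C * u & z (k + 2) = s%:C%C * u].

(** Rescaling turns the coefficients -(t + s), t, s of [u] into -s, t + s, t, with mean 2t/3;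
    subtracting the mean gives the new pair and leaves [k] alone on its side. *)
Lemma flat_triangle_step (R : realType) (z : triangle R) k u (t s : R) :
    0 < t -> 0 < s -> u != 0 ->
  flat_at z k u t s -> flat_at (triangle_step z) k u (t / 3 + s) (t / 3).
Proof.
move=> t0 s0 u0 [zk zk1 zk2].
have [k11 k12 k21 k22] : [/\ k + 1 + 1 = k + 2, k + 1 + 2 = k, k + 2 + 1 = k & k + 2 + 2 = k + 1].
  by move: {zk zk1 zk2} k; apply: forall_Z3; split; apply/val_inj.
have [k0 k2] : k - 1 = k + 2 /\ k + 2 - 1 = k + 1.
  by move: {zk zk1 zk2 k11 k12 k21 k22} k; apply: forall_Z3; split; apply/val_inj.
pose U : R := Num.sqrt (complex.Re u ^+ 2 + complex.Im u ^+ 2).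
have U0 : U != 0.
  by rewrite gt_eqF // -ltcR -normc_def normr_gt0.
have mod_scale i (c : R) : z i = c%:C%C * u -> modulus z i = `|c| * U.
  move=> zi; rewrite /modulus zi ReMr ImMr !exprMn -mulrDr sqrtrM ?sqr_ge0 //.
  by rewrite sqrtr_sqr.
have mk : modulus z k = (t + s) * U.
  by rewrite (mod_scale _ _ zk) normrN gtr0_norm // addr_gt0.
have mk1 : modulus z (k + 1) = t * U by rewrite (mod_scale _ _ zk1) gtr0_norm.
have mk2 : modulus z (k + 2) = s * U by rewrite (mod_scale _ _ zk2) gtr0_norm.
have [tn sn tsn] : [/\ t != 0, s != 0 & t + s != 0] by rewrite !gt_eqF // addr_gt0.
split; rewrite triangle_stepE /= ?k11 ?k12 ?k21 ?k22 ?addrK ?k0 ?k2 mk mk1 mk2 zk zk1 zk2;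
  rewrite !mulrA -!rmorphM -!mulrBl -!rmorphB; congr (_%:C%C * u);
  by field; rewrite U0 tn sn tsn.
Qed.

Lemma Z3_cases (k i : 'Z_3) : i = k \/ i = k + 1 \/ i = k + 2.
Proof.
by move: k i; apply: forall_Z3; apply: forall_Z3; rewrite !ord3_add; tauto.
Qed.

(* The weights 4 and 5 make the functional 4 t + 5 s contract by the factor 4/5
   under (t, s) |-> (t / 3 + s, t / 3). *)
Lemma flat_at_limit (R : realType) (z : triangle R) k u (t s : R) :
    0 < t -> 0 < s -> u != 0 -> flat_at z k u t s ->
  forall i, triangle_iter z n i @[n --> \oo] --> (0 : Cplx R).
Proof.
move=> t0 s0 u0 flat i.
have iter_flat n : exists t' s' : R, [/\ 0 < t', 0 < s',
    flat_at (triangle_iter z n) k u t' s' & 4 * t' + 5 * s' <= (4 * t + 5 * s) * (4 / 5) ^+ n].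
  elim: n => [|n [t' [s' [t'0 s'0 flat' le_n]]]].
    by exists t, s; rewrite expr0 mulr1.
  exists (t' / 3 + s'), (t' / 3); split; [lra|lra|exact: flat_triangle_step|].
  by rewrite exprS; lra.
have bound n : exists2 c : R, triangle_iter z n i = c%:C%C * u
    & `|c| <= (4 * t + 5 * s) * (4 / 5) ^+ n.
  have [t' [s' [t'0 s'0 [zk zk1 zk2] le_n]]] := iter_flat n.
  have [->|[->|->]] := Z3_cases k i.
  - by exists (- (t' + s')) => //; rewrite normrN gtr0_norm; lra.
  - by exists t' => //; rewrite gtr0_norm; lra.
  - by exists s' => //; rewrite gtr0_norm; lra.
have to0 (f : nat -> R) (b : R) :
    (forall n, `|f n| <= (4 * t + 5 * s) * (4 / 5) ^+ n * b) -> f n @[n --> \oo] --> (0 : R).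
  move=> fb; apply/norm_cvg0P.
  apply: (@squeeze_cvgr _ _ _ _ (fun=> 0) (geometric ((4 * t + 5 * s) * b) (4 / 5))).
  - by near=> n; rewrite normr_ge0 /= mulrAC fb.
  - exact: cvg_cst.
  - by apply: cvg_geometric; rewrite ger0_norm; lra.
apply: cvg_Cplx.
- apply: (to0 _ `|complex.Re u|) => n; have [c -> cb] := bound n.
  by rewrite ReMr normrM ler_wpM2r.
- apply: (to0 _ `|complex.Im u|) => n; have [c -> cb] := bound n.
  by rewrite ImMr normrM ler_wpM2r.
Unshelve. all: by end_near.
Qed.

Lemma cross0_proportional (R : realType) (z : triangle R) :
  z 0 != 0 -> cross z = 0 -> exists tau : R, z 1 = tau%:C%C * z 0.
Proof.
move=> z0 S0; rewrite -modulus_gt0 in z0.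
have q0 : complex.Re (z 0) ^+ 2 + complex.Im (z 0) ^+ 2 != 0.
  by rewrite -sqr_modulus gt_eqF ?exprn_gt0.
(* The coefficient of the orthogonal projection of [z 1] onto [z 0]. *)
exists ((complex.Re (z 0) * complex.Re (z 1) + complex.Im (z 0) * complex.Im (z 1))
        / (complex.Re (z 0) ^+ 2 + complex.Im (z 0) ^+ 2)).
apply/eqP; rewrite eq_complex ReMr ImMr; apply/andP; split; apply/eqP.
- apply: (mulIf q0); rewrite mulrAC divfK //.
  have := congr1 (fun x => complex.Im (z 0) * x) S0; rewrite /cross; lra.
- apply: (mulIf q0); rewrite mulrAC divfK //.
  have := congr1 (fun x => complex.Re (z 0) * x) S0; rewrite /cross; lra.
Qed.

Lemma cross0_collinear_limit (R : realType) (z : triangle R) :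
    centered z -> cross z = 0 -> (forall i, z i != 0) ->
  collinear_triangle z /\ forall i, triangle_iter z n i @[n --> \oo] --> (0 : Cplx R).
Proof.
move=> zc S0 znz; have [tau z1] := cross0_proportional (znz 0) S0.
have z0 : z 0 = 1%:C%C * z 0 by rewrite rmorph1 mul1r.
have z2 : z 2 = (- 1 - tau)%:C%C * z 0.
  apply: (addrI (z 0 + z 1)); rewrite zc z1 {1}z0 -!mulrDl -!rmorphD.
  by rewrite (_ : 1 + tau + (- 1 - tau) = 0) ?rmorph0 ?mul0r //; ring.
split.
  exists 0, (z 0); apply: forall_Z3.
  - by exists 1; rewrite add0r -z0.
  - by exists tau; rewrite add0r.
  - by exists (- 1 - tau); rewrite add0r.
have tau0 : tau != 0.
  by apply: contra (znz 1) => /eqP e; rewrite z1 e rmorph0 mul0r.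
have tau1 : - 1 - tau != 0.
  by apply: contra (znz 2) => /eqP e; rewrite z2 e rmorph0 mul0r.
have zN (a : R) : a%:C%C * - z 0 = (- a)%:C%C * z 0 by rewrite rmorphN mulrN mulNr.
(* The nonzero coefficients 1, [tau], [- 1 - tau] sum to 0, so exactly one differs in sign from the
   other two; its index is [k]. *)
have [tau_pos|tau_neg|e] := ltgtP 0 tau; last by rewrite -e eqxx in tau0.
  apply: (flat_at_limit ltr01 tau_pos (znz 0) (k := 2)); split; rewrite ?ord3_add //.
  by rewrite z2; congr (_%:C%C * _); ring.
have [tau1_pos|tau1_neg|e] := ltgtP 0 (- 1 - tau); last by rewrite -e eqxx in tau1.
  apply: (flat_at_limit tau1_pos ltr01 (znz 0) (k := 1)); split; rewrite ?ord3_add //.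
  by rewrite z1; congr (_%:C%C * _); ring.
(* Here 1 is the lone positive coefficient; reversing [u] makes the other two positive. *)
apply: (@flat_at_limit _ z 0 (- z 0) (- tau) (1 + tau)).
- by lra.
- by lra.
- by rewrite oppr_eq0.
- split; rewrite ?ord3_add zN ?opprK //.
  + by rewrite {1}z0; congr (_%:C%C * _); ring.
  + by rewrite z2; congr (_%:C%C * _); ring.
Qed.

Theorem corollary1p1 (R : realType) (z : triangle R)
    (z_distinct : nondegenerate_triangle z)
    (z_centroid : z 0 + z 1 + z 2 = 0)
    (z_nondeg : forall n : nat, nondegenerate_triangle (triangle_iter z n)) :
  exists l : triangle R,
    [/\ equilateral_triangle l,
        forall i : 'Z_3, triangle_iter z n i @[n --> \oo] --> l i
      & ~ collinear_triangle z -> nondegenerate_triangle l].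
Proof.
have znz n i : triangle_iter z n i != 0.
  exact: nondegenerate_step_neq0 (z_nondeg n.+1).
have [S0|S0] := eqVneq (cross z) 0.
  have [col lim0] := cross0_collinear_limit z_centroid S0 (znz 0%N).
  (* The limit is the point triangle, which counts as equilateral; the last clause is vacuous
     because [z] is collinear. *)
  by exists (fun=> 0); split.
have [l [equi lim nd]] := noncollinear_limit z_centroid S0 znz.
by exists l; split.
Qed.
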